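(* Let $d\ge1$ and consider independent site percolation on $\mathbb{Z}^d$ with parameter $p$, where $0<p<p_c$. Let $\zeta(p,d)=\lim_{n\to\infty}-\frac1n\log\mathbb{P}_p(|\mathcal{C}(0)|\ge n)\in(0,\infty)$. Then, as $n\to\infty$, $$\frac{\mathcal{M}_n}{\log n}\longrightarrow\frac{d}{\zeta(p,d)}\qquad\mathbb{P}_p\text{-a.s.}$$
   Context: $\Omega=\{0,1\}^{\mathbb{Z}^d}$; under $\mathbb{P}_p$ the coordinates $\omega(x)$, $x\in\mathbb{Z}^d$, are i.i.d. with $\mathbb{P}_p(\omega(x)=1)=p$. A site $x$ is occupied if $\omega(x)=1$ and vacant otherwise. The cluster $\mathcal{C}(x)=\mathcal{C}(x,\omega)$ of an occupied site $x$ is the largest nearest-neighbour connected set of occupied sites containing $x$; $\mathcal{C}(x)=\emptyset$ if $x$ is vacant. The critical value $p_c=p_c(d)$ is such that a.s. there is no infinite cluster for $p<p_c$ and a.s. there is one for $p>p_c$ (with $p_c(1)=1$). The left endpoint of a set is its minimum in the lexicographic order; $\mathcal{C}_{\rm le}(x,\omega)=\mathcal{C}(x,\omega)$ if $x$ is the left endpoint of $\mathcal{C}(x,\omega)$, and $\mathcal{C}_{\rm le}(x,\omega)=\emptyset$ otherwise. $B_n=[-n,n]^d\cap\mathbb{Z}^d$; $\omega_{B_n}$ denotes the configuration equal to $\omega$ on $B_n$ and to $0$ off $B_n$. The maximal cluster size is $\mathcal{M}_n=\max_x|\mathcal{C}_{\rm le}(x,\omega_{B_n})|$. For $0<p<p_c$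 the limit defining $\zeta$ is known to exist and to be positive. *)

(* Defs.v *)
From HB Require Import structures.
From mathcomp Require Import all_boot all_order all_algebra finmap.
From mathcomp Require Import all_classical all_reals all_analysis.
Set Implicit Arguments.
Unset Strict Implicit.
Unset Printing Implicit Defensive.
Import Order.TTheory GRing.Theory Num.Theory.
Import numFieldNormedType.Exports.
Local Open Scope classical_set_scope.
Local Open Scope ring_scope.

Notation site d := (d.-tuple int).

Definition origin (d : nat) : site d := [tuple 0 | i < d].

Definition nn_adjacent (d : nat) : rel (site d) :=
  fun x y => \sum_(i < d) `|tnth x i - tnth y i| == 1.

Definition lex_le (d : nat) (x y : site d) : bool :=
  ((x : d.-tuplelexi int) <= (y : d.-tuplelexi int))%O.

(* [true] means occupied; the sigma-algebra is the product one, generated by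
   the one-site cylinders. *)
Definition site_cylinders (d : nat) : set (set (site d -> bool)) :=
  [set [set w : site d -> bool | w x] | x in [set: site d]].
Definition config (d : nat) := g_sigma_algebraType (@site_cylinders d).

Section clusters.
Context {d : nat}.
Implicit Types (w : config d) (x y z : site d) (A : set (site d)) (n : nat).

Definition nn_connected A : Prop :=
  forall y z, A y -> A z ->
    exists s : seq (site d),
      [/\ path (@nn_adjacent d) y s, last y s = z & [set` s] `<=` A].

(* The union of all connected sets of occupied sites containing [x] is the
   largest one; there is none, and the union is empty, when [x] is vacant. *)
Definition site_cluster w x : set (site d) :=
  \bigcup_(A in [set A | [/\ nn_connected A, A `<=` [set y | w y] & A x]]) A.

Definition left_endpoint x A : Prop := A x /\ forall y, A y -> lex_le x y.

Definition le_cluster w x : set (site d) :=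
  [set y | left_endpoint x (site_cluster w x) /\ site_cluster w x y].

Definition infinite_cluster w : Prop :=
  exists x, infinite_set (site_cluster w x).

Definition box n : {pred site d} :=
  [pred x | [forall i : 'I_d, `|tnth x i| <= n%:Z]].

Definition restrict_box n w : config d := fun x => w x && (x \in box n).

End clusters.

Section percolation.
Context {R : realType} {d : nat}.

(* The clusters of [restrict_box n w] lie in a finite box, so [fset_set] gives
   their true cardinality, and the supremum is that of a finite set of
   values. *)
Definition max_cluster (n : nat) (w : config d) : R :=
  sup [set (#|` fset_set (le_cluster (restrict_box n w) x)|)%:R
      | x in [set: site d]].

(* Under [P] the coordinates are i.i.d. with P(w x = 1) = p. *)
Definition percolation_law (p : R) (P : probability (config d) R) : Prop :=
  (forall x : site d, P [set w : config d | w x] = p%:E) /\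
  (forall (S : {fset site d}) (E : site d -> set bool),
     P (\bigcap_(x in [set` S]) [set w | E x (w x)]) =
     (\prod_(x <- S) P [set w | E x (w x)])%E).

(* - (1/n) log P(|C(0)| >= n); [`I_n #<= A] says that [A], finite or infinite,
   has at least [n] elements. *)
Definition cluster_tail_rate (P : probability (config d) R) (n : nat) : R :=
  - (n%:R^-1 * ln (fine (P [set w | (`I_n #<= site_cluster w (origin d))%card]))).

Definition zeta (P : probability (config d) R) : R :=
  limn (cluster_tail_rate P).

End percolation.

(* The supremum is over [0, 1], whence the value 1 in dimension 1. *)
Definition p_c (R : realType) (d : nat) : R :=
  sup [set q : R | 0 <= q <= 1 /\
    exists2 P : probability (config d) R, percolation_law q P &
      {ae P, forall w : config d, ~ infinite_cluster w}].

(* Main.v *)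
Require Import Defs.
From HB Require Import structures.
From mathcomp Require Import all_boot all_order all_algebra finmap.
From mathcomp Require Import all_classical all_reals all_analysis.
From mathcomp Require Import zify ring lra.
Import Order.TTheory GRing.Theory Num.Theory.
Import numFieldNormedType.Exports.
Local Open Scope classical_set_scope.
Local Open Scope ring_scope.

(* Let pi_m = P(|C(0)| >= m), so that pi_m = exp(-(zeta + o(1)) m). A cluster
   with at least m sites already has m sites within distance m of its root, so
   {|C(x)| >= m} depends only on the cube of radius m about x.
   Take n = 2^k and m ~ c log n. The union bound gives
   P(M_n > c log n) <= (2n + 1)^d pi_m, which is summable in k if c > d/zeta.
   Conversely B_n contains N^d disjoint cubes of radius m with N ~ n/(2m + 1),
   and by independence P(M_n < m) <= (1 - pi_m)^(N^d) <= 1/(N^d pi_m), which is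
   summable in k if c < d/zeta. Borel-Cantelli settles n = 2^k, and the other n
   follow because M_n is nondecreasing in n. *)

(** * Clusters as sets reached by occupied paths, and their localisation *)

Lemma card_geP (T : choiceType) (A : set T) (m : nat) :
  (`I_m #<= A)%card <->
  exists2 X : {fset T}, [set` X] `<=` A & (m <= #|` X|)%N.
Proof.
split=> [mA|[X XA mX]].
  have [fA|/(@infinite_set_fset _ _ m)//] := pselect (finite_set A).
  by exists (fset_set A); [rewrite fset_setK|exact: leq_card_fset_set].
apply: card_le_trans (subset_card_le XA).
have XE : ([set` X] #= `I_#|` X|)%card by apply/card_eq_fsetP.
by rewrite (card_le_eqr XE) card_le_II.
Qed.

Section cluster_combinatorics.
Context {d : nat}.
Implicit Types (w : config d) (x y z : site d).

(** Only the arrival site of a step is tested, so a path of such steps says nothing about its first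
    site; hence the separate condition [w x] below. *)
Let occ_adj w : rel (site d) := fun y z => nn_adjacent y z && w z.

Lemma nn_adjacent_sym x y : nn_adjacent x y = nn_adjacent y x.
Proof. by rewrite /nn_adjacent; under eq_bigr do rewrite distrC. Qed.

Lemma nn_adjacent_dist x y (i : 'I_d) :
  nn_adjacent x y -> `|tnth x i - tnth y i| <= 1.
Proof.
move=> /eqP <-; rewrite (bigD1 i)//= lerDl.
by apply: sumr_ge0.
Qed.

(** A connected set supplies the path. Conversely, the set of sites reached from [x] is itself
    connected: any two of them are joined by going back to [x] and out again. *)
Lemma site_clusterP w x y : site_cluster w x y <->
  w x /\ exists2 s, path (occ_adj w) x s & last x s = y.
Proof.
split=> [[A [cA Aw Ax] Ay]|[wx [s ps <-]]].
  split; first exact: Aw.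
  have [s [ps <- sA]] := cA _ _ Ax Ay; exists s => //.
  elim: s (x) ps sA => //= z s IH u /andP[uz ps] sA.
  rewrite /occ_adj uz IH// ?andbT.
    by apply: Aw; apply: sA; rewrite /= inE eqxx.
  by move=> v sv; apply: sA => /=; rewrite inE sv orbT.
pose A := [set y | w y /\ exists2 s, path (occ_adj w) x s & last x s = y].
have lastw z t : w z -> path (occ_adj w) z t -> w (last z t).
  by elim: t z => //= a t IH z _ /andP[/andP[_ wa]]; exact: IH.
have Alast t : path (occ_adj w) x t -> A (last x t).
  by move=> pt; split; [exact: lastw|exists t].
exists A; last exact: Alast.
split; last by split=> //; exists [::].
- have fromx t u : path (occ_adj w) x (t ++ u) ->
      [/\ path (@nn_adjacent d) (last x t) u & [set` u] `<=` A].
    move=> p; split.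
      move: p; rewrite cat_path => /andP[_]; elim: u (last x t) => //= a u IH v.
      by move=> /andP[/andP[-> _] /IH].
    move=> v /= vu; have vtu : v \in t ++ u by rewrite mem_cat vu orbT.
    case/path.splitP: vtu p => p1 p2.
    by rewrite cat_path => /andP[/Alast]; rewrite last_rcons.
  have tox t : path (occ_adj w) x t -> exists u,
      [/\ path (@nn_adjacent d) (last x t) u, last (last x t) u = x
        & [set` u] `<=` A].
    (* The path [x :: t] read backwards from its endpoint: [belast] drops that endpoint and keeps
       [x], which becomes the last site. *)
    move=> pt; exists (rev (belast x t)); split.
    + rewrite rev_path; have [+ _] := fromx [::] t pt => /=.
      by apply: sub_path => a b; rewrite nn_adjacent_sym.
    + by case: t pt => //= a t _; rewrite rev_cons last_rcons.
    + move=> v /=; rewrite mem_rev => /mem_belast; rewrite inE => /orP[/eqP ->|].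
        by split=> //; exists [::].
      by have [_] := fromx [::] t pt; apply.
  move=> _ _ [_ [t pt <-]] [_ [u pu <-]].
  have [v [pv lv vA]] := tox t pt; exists (v ++ u); split.
  + by rewrite cat_path pv lv; have [] := fromx [::] u pu.
  + by rewrite last_cat lv.
  + move=> a /=; rewrite mem_cat => /orP[/vA//|].
    by have [_] := fromx [::] u pu; apply.
- by move=> z [].
Qed.

Lemma cluster_refl w x : w x -> site_cluster w x x.
Proof. by move=> wx; apply/site_clusterP; split=> //; exists [::]. Qed.

Lemma cluster_root w x y : site_cluster w x y -> w x.
Proof. by move=> /site_clusterP[]. Qed.

Lemma cluster_occ w x y : site_cluster w x y -> w y.
Proof. by case=> A [_ Aw _] /Aw. Qed.

Lemma cluster_step w x y z :
  site_cluster w x y -> nn_adjacent y z -> w z -> site_cluster w x z.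
Proof.
move=> /site_clusterP[wx [s ps sy]] yz wz; apply/site_clusterP; split=> //.
by exists (rcons s z); rewrite ?last_rcons// rcons_path ps sy /occ_adj yz.
Qed.

Lemma cluster_mono w w' x :
  (forall y, w y -> w' y) -> site_cluster w x `<=` site_cluster w' x.
Proof.
move=> ww' y /site_clusterP[/ww' wx [s ps sy]]; apply/site_clusterP; split=> //.
by exists s => //; apply: sub_path ps => a b /andP[ab /ww'] /=; rewrite /occ_adj ab.
Qed.

Lemma cluster_trans w x y z :
  site_cluster w x y -> site_cluster w y z -> site_cluster w x z.
Proof.
move=> /site_clusterP[wx [s ps <-]] /site_clusterP[_ [t pt <-]].
apply/site_clusterP; split=> //; exists (s ++ t); rewrite ?last_cat//.
by rewrite cat_path ps.
Qed.

Lemma cluster_sym w x y : site_cluster w x y -> site_cluster w y x.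
Proof.
case=> A [cA Aw Ax] Ay; exists A => //; split=> //.
Qed.

Lemma cluster_eq w x y :
  site_cluster w x y -> site_cluster w x = site_cluster w y.
Proof.
move=> xy; apply/seteqP; split=> z; last exact: cluster_trans.
exact/cluster_trans/cluster_sym.
Qed.

(** Follow an occupied path from [x] to [y] up to its first step out of [X]. *)
Lemma cluster_exit w x y (X : {pred site d}) :
  site_cluster w x y -> x \in X -> y \notin X ->
  exists u v, [/\ u \in X, v \notin X, nn_adjacent u v & w v].
Proof.
move=> /site_clusterP[_ [s + <-]]; elim: s x => [x _ -> //|a s IH x /=].
move=> /andP[/andP[xa wa] ps] xX lX; have [aX|aX] := boolP (a \in X).
  exact: (IH a).
by exists x, a.
Qed.

Definition cube x (k : nat) : {pred site d} :=
  [pred y | [forall i : 'I_d, `|tnth y i - tnth x i| <= k%:Z]].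

Definition restrict_cube x k w : config d := fun y => w y && (y \in cube x k).

Lemma cube_center x k : x \in cube x k.
Proof. by apply/forallP => i; rewrite subrr normr0. Qed.

Lemma cubeS x j k y : (j <= k)%N -> y \in cube x j -> y \in cube x k.
Proof.
move=> jk /forallP jy; apply/forallP => i; apply: le_trans (jy i) _.
by rewrite lez_nat.
Qed.

Lemma cube_step x k y z : y \in cube x k -> nn_adjacent y z -> z \in cube x k.+1.
Proof.
move=> /forallP ky yz; apply/forallP => i; apply: le_trans (ler_distD (tnth y i) _ _) _.
by rewrite -addn1 PoszD addrC lerD// distrC nn_adjacent_dist.
Qed.

(* A cluster reaching outside [cube x m] has already collected [m] sites inside:
   a set of sites of the cluster grown one neighbour at a time gets at most one
   step further from [x] with each site. *)
Lemma card_ge_cluster_restrict_cube w x m :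
  (`I_m #<= site_cluster w x)%card <->
  (`I_m #<= site_cluster (restrict_cube x m w) x)%card.
Proof.
split; last first.
  by move=> /card_le_trans; apply; apply/subset_card_le/cluster_mono => y /andP[].
case: m => [_|m /card_geP[Y YC mY]].
  by apply/card_geP; exists fset0 => //= y.
have wx : w x.
  have : (0 < #|` Y|)%N by exact: leq_trans mY.
  by rewrite cardfs_gt0 => /fset0Pn[y /YC/cluster_root].
apply/card_geP.
(* The induction starts from the single site [x] in the cube of radius 0, so it yields [m + 1] sites
   within radius [m], one unit of radius better than required. *)
suff [X [_ mX XC]] : exists X : {fset site d}, [/\ x \in X, (m < #|` X|)%N &
    [set` X] `<=` site_cluster (restrict_cube x m w) x].
  exists X => //; apply: subset_trans XC _; apply: cluster_mono => y /andP[wy ym].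
  by rewrite /restrict_cube wy (cubeS _ _ _ _ (leqnSn m)).
elim: m mY => [|k IH] kY.
  exists [fset x]%fset; split; rewrite ?inE ?cardfs1//.
  move=> y /=; rewrite inE => /eqP ->.
  by apply: cluster_refl; rewrite /restrict_cube wx cube_center.
have [|X [xX kX XC]] := IH; first exact: ltnW.
have mono : site_cluster (restrict_cube x k w) x `<=`
    site_cluster (restrict_cube x k.+1 w) x.
  apply: cluster_mono => y /andP[wy yk].
  by rewrite /restrict_cube wy (cubeS _ _ _ _ (leqnSn k)).
have [kX'|kX'] := ltnP k.+1 #|` X|.
  by exists X; split=> //; exact: subset_trans mono.
have /fsubsetPn[y yY yX] : ~~ (Y `<=` X)%fset.
  by apply/negP => /fsubset_leq_card; rewrite leqNgt (leq_ltn_trans kX').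
have [u [v]] := cluster_exit _ _ _ (fun z => z \in X) (YC y yY) xX yX.
rewrite !unfold_in => -[uX vX uv wv].
exists (v |` X)%fset; split; first by rewrite !inE xX orbT.
  by rewrite cardfsU1 vX.
have uC : site_cluster (restrict_cube x k w) x u by exact: XC.
move=> z /=; rewrite !inE => /orP[/eqP ->|zX]; last exact/mono/XC.
apply: (cluster_step _ _ _ _ (mono _ uC) uv); rewrite /restrict_cube wv/=.
have /andP[_ uk] := cluster_occ _ _ _ uC.
exact: cube_step uk uv.
Qed.

End cluster_combinatorics.

(** * Finiteness and volume of cubes *)

Section cubes.
Context {d : nat}.
Implicit Types (w : config d) (x y z : site d).

(** Offsets run from 0 to 2k and are recentred by -k, so the functions [f] parametrise the cube and
    their number gives the volume bound. *)
Definition cube_site x k (f : {ffun 'I_d -> 'I_k.*2.+1}) : site d :=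
  [tuple tnth x i + (f i : nat)%:Z - k%:Z | i < d].

Definition cube_fset x k : {fset site d} :=
  [fset cube_site x k f | f in {ffun 'I_d -> 'I_k.*2.+1}]%fset.

Lemma in_cube_fset x k y : (y \in cube_fset x k) = (y \in cube x k).
Proof.
apply/imfsetP/forallP => [[f _ ->] i|yk].
  rewrite tnth_mktuple; have := ltn_ord (f i).
  by move: (tnth x i) (f i : nat) => a b; lia.
have fP i : (absz (tnth y i - tnth x i + k%:Z)%R < k.*2.+1)%N.
  by have := yk i; move: (tnth x i) (tnth y i) => a b; lia.
exists [ffun i => Ordinal (fP i)] => //.
apply: eq_from_tnth => i; rewrite tnth_mktuple ffunE /=.
by have := yk i; move: (tnth x i) (tnth y i) => a b; lia.
Qed.

Lemma card_cube_fset x k : (#|` cube_fset x k| <= k.*2.+1 ^ d)%N.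
Proof.
apply: leq_trans (leq_imfset_card _ _ _) _.
by rewrite -cardE card_ffun !card_ord.
Qed.

Lemma in_box n x : (x \in box n) = (x \in cube (origin d) n).
Proof. by apply: eq_forallb => i; rewrite tnth_mktuple subr0. Qed.

Lemma restrict_boxE n w : restrict_box n w = restrict_cube (origin d) n w.
Proof. by apply/funext => x; rewrite /restrict_box in_box. Qed.

Lemma finite_cube x k : finite_set [set` cube x k].
Proof.
apply: sub_finite_set (finite_fset (cube_fset x k)) => y /=.
by rewrite in_cube_fset.
Qed.

Lemma cluster_restrict_cube_sub w x k y :
  site_cluster (restrict_cube x k w) y `<=` [set` cube x k].
Proof. by move=> z /cluster_occ /andP[]. Qed.

Lemma finite_cluster_restrict_box n w x :
  finite_set (site_cluster (restrict_box n w) x).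
Proof.
rewrite restrict_boxE; apply: sub_finite_set (finite_cube (origin d) n).
exact: cluster_restrict_cube_sub.
Qed.

Lemma left_endpoint_exists (A : set (site d)) :
  finite_set A -> A !=set0 -> exists x, left_endpoint x A.
Proof.
move=> fA [a Aa]; have aA : a \in fset_set A by rewrite in_fset_set// inE.
pose F (z : fset_set A) : d.-tuplelexi int := fsval z.
have [x _ xmin] := @Order.TotalTheory.arg_minP _ _ _ [`aA]%fset xpredT F isT.
exists (val x); split.
  by have := valP x; rewrite in_fset_set// inE.
move=> y Ay; have yA : y \in fset_set A by rewrite in_fset_set// inE.
exact: (xmin [`yA]%fset isT).
Qed.

End cubes.

(** * Comparison of the maximal cluster with individual clusters *)

Section max_cluster_bounds.
Context {R : realType} {d : nat}.
Implicit Types (w : config d) (x y z : site d).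

Let cluster_card n w x : nat := #|` fset_set (site_cluster (restrict_box n w) x)|.

Lemma cluster_card_le n w x : (cluster_card n w x <= n.*2.+1 ^ d)%N.
Proof.
apply: leq_trans (card_cube_fset (origin d) n); apply: fsubset_leq_card.
apply/fsubsetP => y; rewrite in_fset_set ?inE; last exact: finite_cluster_restrict_box.
by rewrite restrict_boxE in_cube_fset => /cluster_restrict_cube_sub.
Qed.

Lemma le_clusterE n w x :
  le_cluster (restrict_box n w) x = set0 \/
  [/\ le_cluster (restrict_box n w) x = site_cluster (restrict_box n w) x
    & x \in box n].
Proof.
have [xl|xl] := pselect (left_endpoint x (site_cluster (restrict_box n w) x)).
  right; split; first by apply/seteqP; split=> y => [[]//|]; split.
  by case: xl => /cluster_root /andP[].
by left; apply/seteqP; split=> y => [[]//|].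
Qed.

(** A nonempty cluster in the box is finite, hence has a left endpoint [y], and [le_cluster] at [y]
    is the whole cluster. If the cluster is empty, [x] itself serves. *)
Lemma cluster_card_le_max n w x : (cluster_card n w x)%:R <= max_cluster n w :> R.
Proof.
have [y yx] : exists y, le_cluster (restrict_box n w) y =
                        site_cluster (restrict_box n w) x.
  have [/set0P C0|] := boolP (site_cluster (restrict_box n w) x != set0).
    have [y [xy ymin]] := left_endpoint_exists _ (finite_cluster_restrict_box n w x) C0.
    have [yl|[yl _]] := le_clusterE n w y; last by exists y; rewrite yl (cluster_eq _ _ _ xy).
    have : le_cluster (restrict_box n w) y y.
      by rewrite /le_cluster /= -(cluster_eq _ _ _ xy).
    by move: yl => /(congr1 (@^~ y)) ->.
  rewrite negbK => /eqP C0; exists x; rewrite C0.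
  by have [//|[]] := le_clusterE n w x; rewrite C0.
(* A real [sup] dominates its set only when the set is bounded; the volume of the box is a bound. *)
apply: ub_le_sup; last by exists y => //; rewrite yx.
exists (n.*2.+1 ^ d)%:R => _ [z _ <-]; rewrite ler_nat.
have [->|[-> _]] := le_clusterE n w z; last exact: cluster_card_le.
by rewrite fset_set0 cardfs0.
Qed.

Lemma max_cluster_ge0 n w : 0 <= max_cluster n w :> R.
Proof. exact: le_trans (ler0n _ _) (cluster_card_le_max n w (origin d)). Qed.

(** Sites that are not left endpoints contribute 0, so with [0 <= t] a value above [t] comes from a
    genuine left endpoint, which lies in the box. *)
Lemma max_cluster_gt n w (t : R) : 0 <= t -> t < max_cluster n w ->
  exists2 x, x \in box n & t < (cluster_card n w x)%:R.
Proof.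
move=> t0 tM; have [|_ [x _ <-]] := sup_gt _ tM.
  by exists (#|` fset_set (le_cluster (restrict_box n w) (origin d))|%:R); exists (origin d).
have [->|[-> xn] tx] := le_clusterE n w x; last by exists x.
by rewrite fset_set0 cardfs0 ltNge t0.
Qed.

(** By localisation [m] sites of the cluster are already connected to [x] inside the cube, so
    truncation to a box containing the cube keeps them. *)
Lemma max_cluster_ge n w x m :
  (`I_m #<= site_cluster w x)%card -> {subset cube x m <= box n} ->
  m%:R <= max_cluster n w :> R.
Proof.
move=> mC xn; apply: le_trans (cluster_card_le_max n w x); rewrite ler_nat.
apply: leq_card_fset_set; first exact: finite_cluster_restrict_box.
move/card_ge_cluster_restrict_cube: mC => /card_le_trans; apply.
apply/subset_card_le/cluster_mono => y /andP[wy yx].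
by rewrite /restrict_box wy xn.
Qed.

Lemma max_cluster_le n m w : (n <= m)%N -> max_cluster n w <= max_cluster m w :> R.
Proof.
move=> nm; apply: ge_sup => [|_ [x _ <-]].
  by exists (#|` fset_set (le_cluster (restrict_box n w) (origin d))|%:R); exists (origin d).
apply: le_trans (cluster_card_le_max m w x); rewrite ler_nat.
apply/fsubset_leq_card/fsubsetP => y; rewrite in_fset_set; last first.
  have [->|[-> _]] := le_clusterE n w x; first exact: finite_set0.
  exact: finite_cluster_restrict_box.
rewrite in_fset_set ?inE; last exact: finite_cluster_restrict_box.
case=> _; apply: cluster_mono => z /andP[wz]; rewrite /restrict_box wz !in_box.
exact: cubeS.
Qed.

Lemma card_ge_cluster_card n w x m : (m <= cluster_card n w x)%N ->
  (`I_m #<= site_cluster w x)%card.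
Proof.
move=> mC; apply/card_geP.
exists (fset_set (site_cluster (restrict_box n w) x)) => //.
rewrite fset_setK; last exact: finite_cluster_restrict_box.
by apply: cluster_mono => y /andP[].
Qed.

End max_cluster_bounds.

(** * Events depending on finitely many sites *)

Section finite_dependence.
Context {d : nat}.
Implicit Types (w : config d) (s : site d) (S T : {fset site d}).
Implicit Types (A B : set (config d)).

Definition depends_on S A : Prop :=
  forall w w', {in S, w =1 w'} -> A w -> A w'.

Definition site_event s (b : bool) : set (config d) := [set w | w s = b].

Definition site_split s (A : bool -> set (config d)) : set (config d) :=
  (A true `&` site_event s true) `|` (A false `&` site_event s false).

Lemma measurable_site_event s b : measurable (site_event s b).
Proof.
have mT : measurable (site_event s true).
  by apply: sub_sigma_algebra; exists s.
case: b => //; rewrite (_ : site_event s false = ~` site_event s true).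
  exact: measurableC.
by apply/seteqP; split=> w; rewrite /site_event/=; case: (w s).
Qed.

Lemma measurable_site_split s (A : bool -> set (config d)) :
  (forall b, measurable (A b)) -> measurable (site_split s A).
Proof.
by move=> mA; apply: measurableU; apply: measurableI => //;
  exact: measurable_site_event.
Qed.

(** Induction on the number of sites: forcing the state of [s] to each value turns [A] into two
    events that depend on the remaining sites only. With no site left, an event is empty or
    everything. *)
Lemma depends_on_ind (Q : {fset site d} -> set (config d) -> Prop) :
  Q fset0 set0 -> Q fset0 setT ->
  (forall s S (A : bool -> set (config d)), s \notin S ->
    (forall b, depends_on S (A b)) -> (forall b, Q S (A b)) ->
    Q (s |` S)%fset (site_split s A)) ->
  forall S A, depends_on S A -> Q S A.
Proof.
move=> Q0 QT Qsplit S.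
have [n] := ubnP #|` S|; elim: n S => // n IH S Sn A AS.
have [S0|/fset0Pn[s sS]] := eqVneq S fset0.
  rewrite S0 in AS *; have [/eqP ->//|/set0P[w Aw]] := boolP (A == set0).
  by rewrite (_ : A = setT)//; apply/seteqP; split=> // w' _; exact: AS Aw.
pose upd w b : config d := fun x => if x == s then b else w x.
have updS w b : {in S, forall x, w s = b -> upd w b x = w x}.
  by move=> x _ <-; rewrite /upd; case: eqP => [->|].
pose A' b := [set w | A (upd w b)].
have -> : A = site_split s A'.
  apply/seteqP; split=> w.
    move=> Aw; case ws: (w s); [left|right]; split=> //; rewrite /A' /=;
      by apply: AS Aw => x xS; rewrite updS.
  by case=> -[+ ws]; apply: AS => x xS; rewrite updS.
have A'S b : depends_on (S `\ s)%fset (A' b).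
  move=> w w' ww'; rewrite /A'/=; apply: AS => x xS; rewrite /upd.
  by case: eqVneq => // xs; apply: ww'; rewrite !inE xs.
rewrite -(fsetD1K sS); apply: Qsplit => //; first by rewrite !inE eqxx.
move=> b; apply: IH => //.
by move: Sn; rewrite (cardfsD1 s) sS.
Qed.

Lemma depends_on_measurable S A : depends_on S A -> measurable A.
Proof.
move=> AS; apply: (@depends_on_ind (fun _ B => measurable B) _ _ _ S) => //.
by move=> *; exact: measurable_site_split.
Qed.

Lemma depends_onI S T A B :
  depends_on S A -> depends_on T B -> depends_on (S `|` T)%fset (A `&` B).
Proof.
move=> AS BT w w' ww' [Aw Bw]; split.
  by apply: AS Aw => x xS; apply: ww'; rewrite inE xS.
by apply: BT Bw => x xT; apply: ww'; rewrite inE xT orbT.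
Qed.

Lemma depends_onC S A : depends_on S A -> depends_on S (~` A).
Proof. by move=> AS w w' ww' nAw /AS Aw; apply/nAw/Aw => x /ww'. Qed.

Lemma depends_on_site s b : depends_on [fset s]%fset (site_event s b).
Proof. by move=> w w' ww' <-; rewrite /site_event/= ww' ?inE. Qed.

End finite_dependence.

(** * Independence and invariance under relabelling of sites *)

Section independence.
Context {R : realType} {d : nat} {p : R} {P : probability (config d) R}.
Hypothesis P_law : percolation_law p P.
Implicit Types (s : site d) (S T : {fset site d}) (A B : set (config d)).
Local Open Scope ereal_scope.

Lemma probability_site_split s (A : bool -> set (config d)) :
  (forall b, measurable (A b)) ->
  P (site_split s A) =
  P (A true `&` site_event s true) + P (A false `&` site_event s false).
Proof.
move=> mA; rewrite measureU//.
- by apply: measurableI => //; exact: measurable_site_event.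
- by apply: measurableI => //; exact: measurable_site_event.
- apply/seteqP; split=> // w [[_ +] [_]]; rewrite /site_event /= => -> //.
Qed.

Lemma probability_site_event s b :
  P (site_event s b) = if b then p%:E else (1 - p)%:E.
Proof.
have [P1 _] := P_law; case: b; first exact: P1.
rewrite (_ : site_event s false = ~` site_event s true); last first.
  by apply/seteqP; split=> w; rewrite /site_event/=; case: (w s).
by rewrite probability_setC ?EFinB ?P1//; exact: measurable_site_event.
Qed.

(** These are the events whose probabilities [percolation_law] factorises. *)
Let cylinder T (E : site d -> set bool) : set (config d) :=
  \bigcap_(x in [set` T]) [set w | E x (w x)].

Let depends_on_cylinder T E : depends_on T (cylinder T E).
Proof. by move=> w w' ww' wE x /= xT; rewrite -ww'//; exact: wE. Qed.

Let cylinderU1 s T (E : site d -> set bool) b : s \notin T ->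
  site_event s b `&` cylinder T E =
  cylinder (s |` T)%fset (fun x => if x == s then [set b] else E x).
Proof.
move=> sT; have xs x : x \in T -> (x == s) = false.
  by move=> xT; apply: contraNF sT => /eqP <-.
apply/seteqP; split=> w.
  move=> [ws wE] x /=; rewrite !inE => /orP[/eqP ->|xT]; first by rewrite eqxx.
  by rewrite xs//; exact: wE.
move=> wE; split; first by have := wE s; rewrite /= !inE eqxx; apply.
by move=> x xT; have := wE x; rewrite /= !inE xs// xT; apply.
Qed.

Let probability_cylinderU1 s T E b : s \notin T ->
  P (site_event s b `&` cylinder T E) = P (site_event s b) * P (cylinder T E).
Proof.
move=> sT; have [_ law] := P_law.
rewrite cylinderU1// (law T E) (law _ (fun x => if x == s then [set b] else E x)).
rewrite big_fsetU1//= eqxx; congr (P _ * _).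
apply: eq_big_seq => x xT; rewrite ifN//.
by apply: contraNN sT => /eqP <-.
Qed.

(** Induction on [S]: once the state of [s] is fixed, the condition at [s] is absorbed into the
    cylinder, so the induction hypothesis is applied over a larger set of sites. This is why it is
    kept for all [T] and [E]. *)
Let independent_cylinder S A : depends_on S A ->
  forall T E, [disjoint S & T]%fset -> P (A `&` cylinder T E) = P A * P (cylinder T E).
Proof.
move: S A; apply: depends_on_ind => [T E _|T E _|s S A sS AS IH T E].
- by rewrite set0I measure0 mul0e.
- by rewrite setTI probability_setT mul1e.
rewrite fdisjointU1X => /andP[sT ST].
have mA b : measurable (A b) by exact: depends_on_measurable (AS b).
have mT : measurable (cylinder T E).
  exact: depends_on_measurable (@depends_on_cylinder T E).
have IHs U F b : [disjoint S & U]%fset -> s \notin U ->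
    P (A b `&` (site_event s b `&` cylinder U F)) =
    P (A b) * P (site_event s b) * P (cylinder U F).
  move=> SU sU; rewrite -muleA -probability_cylinderU1// cylinderU1// IH//.
  by rewrite fdisjointXU fdisjointX1 sS.
(* Over the empty set of sites the cylinder is the whole space, which leaves independence from the
   site [s] alone. *)
have IH0 b : P (A b `&` site_event s b) = P (A b) * P (site_event s b).
  have := IHs fset0 E b (fdisjointX0 _) isT.
  have -> : cylinder fset0 E = setT by apply/seteqP; split.
  by rewrite setIT probability_setT mule1.
have -> : site_split s A `&` cylinder T E = site_split s (fun b => A b `&` cylinder T E).
  by rewrite /site_split setIUl !(setIAC _ _ (cylinder T E)).
rewrite !probability_site_split//; last by move=> b; exact: measurableI.
have IHT b : P (A b `&` cylinder T E `&` site_event s b) =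
    P (A b) * P (site_event s b) * P (cylinder T E).
  by rewrite setIAC -setIA IHs.
by rewrite !IHT !IH0 ge0_muleDl// mule_ge0.
Qed.

Lemma independent_site S A s b : depends_on S A -> s \notin S ->
  P (A `&` site_event s b) = P A * P (site_event s b).
Proof.
move=> AS sS.
have -> : site_event s b = cylinder [fset s]%fset (fun=> [set b]).
  apply/seteqP; split=> [w ws x /=|w]; first by rewrite inE => /eqP ->.
  by move=> /(_ s); apply; rewrite /= inE.
by apply: independent_cylinder AS _ _ _; rewrite fdisjointX1.
Qed.

(** A second induction, now on [T]: the condition at [s] is moved into the other event, so the
    hypothesis must hold for all [S] and [A]. *)
Lemma independent_depends_on S T A B :
  depends_on S A -> depends_on T B -> [disjoint S & T]%fset ->
  P (A `&` B) = P A * P B.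
Proof.
move=> AS BT; move: T B BT S A AS.
apply: depends_on_ind => [S A _ _|S A _ _|s T B sT BT IH S A AS].
- by rewrite setI0 measure0 mule0.
- by rewrite setIT probability_setT mule1.
rewrite fdisjointXU fdisjointX1 => /andP[sS ST].
have mA := depends_on_measurable _ _ AS.
have mB b : measurable (B b) by exact: depends_on_measurable (BT b).
have -> : A `&` site_split s B = site_split s (fun b => A `&` B b).
  by rewrite /site_split setIUr !setIA.
rewrite !probability_site_split//; last by move=> b; exact: measurableI.
have E b : P (A `&` B b `&` site_event s b) = P A * P (B b `&` site_event s b).
  rewrite setIAC (IH b (S `|` [fset s])%fset); last 2 first.
  - by apply: depends_onI => //; exact: depends_on_site.
  - by rewrite fdisjointUX ST fdisjoint1X.
  rewrite (independent_site _ _ _ _ AS sS) (independent_site _ _ _ _ (BT b) sT).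
  by rewrite -muleA (muleC (P (site_event s b))).
by rewrite !E ge0_muleDr.
Qed.

(** Splitting on the state of [s] on one side and of [f s] on the other gives the same recursion,
    because all sites have the same marginal law; injectivity keeps [f s] outside the image of
    [S]. *)
Lemma probability_reindex S A (f : site d -> site d) : injective f ->
  depends_on S A -> P [set w : config d | A (w \o f)] = P A.
Proof.
move=> finj; move: S A; apply: depends_on_ind => // s S A sS AS IH.
pose A' b := [set w : config d | A b (w \o f)].
have A'S b : depends_on (f @` S)%fset (A' b).
  by move=> w w' ww'; apply: AS => x xS /=; apply: ww'; rewrite in_imfset.
have fsS : f s \notin (f @` S)%fset.
  by apply: contraNN sS => /imfsetP[x /= xS /finj ->].
have -> : [set w : config d | site_split s A (w \o f)] = site_split (f s) A'.
  by [].
rewrite !probability_site_split; last 2 first.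
- by move=> b; exact: depends_on_measurable (AS b).
- by move=> b; exact: depends_on_measurable (A'S b).
rewrite !(independent_site _ _ _ _ (AS _) sS) !(independent_site _ _ _ _ (A'S _) fsS).
by rewrite !IH !probability_site_event.
Qed.

(** Events are peeled off one at a time: the intersection of the others depends on the union of
    their sets of sites, which is disjoint from the first. *)
Lemma probability_bigI (I : eqType) (r : seq I) (D : I -> {fset site d})
    (A : I -> set (config d)) :
  (forall i, depends_on (D i) (A i)) ->
  pairwise (fun i j => [disjoint D i & D j]%fset) r ->
  P (\big[setI/setT]_(i <- r) A i) = \prod_(i <- r) P (A i).
Proof.
move=> AD.
have dep (q : seq I) : depends_on (\big[fsetU/fset0]_(i <- q) D i)%fset
    (\big[setI/setT]_(i <- q) A i).
  elim: q => [|i q IH]; first by rewrite !big_nil.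
  by rewrite !big_cons; exact: depends_onI.
elim: r => [_|i r IH]; first by rewrite !big_nil probability_setT.
rewrite pairwise_cons => /andP[ir pr]; rewrite !big_cons -IH//.
apply: independent_depends_on (AD i) (dep r) _.
elim: r ir {IH pr} => [_|j r IH]; first by rewrite big_nil fdisjointX0.
by rewrite /= big_cons fdisjointXU => /andP[-> /IH].
Qed.

End independence.

(** * Large clusters: locality, translation, and packing of disjoint cubes *)

Section cluster_events.
Context {d : nat}.
Implicit Types (w : config d) (x y z : site d).

Definition big_cluster x m : set (config d) :=
  [set w | (`I_m #<= site_cluster w x)%card].

Lemma depends_on_big_cluster x m : depends_on (cube_fset x m) (big_cluster x m).
Proof.
move=> w w' ww' /card_ge_cluster_restrict_cube wx.
apply/card_ge_cluster_restrict_cube; move: wx.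
rewrite (_ : restrict_cube x m w = restrict_cube x m w')//.
apply/funext => y; rewrite /restrict_cube andbC [RHS]andbC.
by have [yx|//] := boolP (y \in cube x m); rewrite ww'// in_cube_fset.
Qed.

Lemma measurable_big_cluster x m : measurable (big_cluster x m).
Proof. exact: depends_on_measurable (depends_on_big_cluster x m). Qed.

Definition shift x y : site d := [tuple tnth y i + tnth x i | i < d].

Lemma shift_inj x : injective (shift x).
Proof.
move=> y z yz; apply: eq_from_tnth => i; apply: (addIr (tnth x i)).
by have := congr1 (fun t => tnth t i) yz; rewrite !tnth_mktuple.
Qed.

Lemma shift_origin x : shift x (origin d) = x.
Proof. by apply: eq_from_tnth => i; rewrite !tnth_mktuple add0r. Qed.

Lemma nn_adjacent_shift x y z : nn_adjacent (shift x y) (shift x z) = nn_adjacent y z.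
Proof.
by rewrite /nn_adjacent; under eq_bigr do rewrite !tnth_mktuple opprD addrACA subrr addr0.
Qed.

Lemma big_cluster_shift_sub x y m w :
  big_cluster y m (w \o shift x) -> big_cluster (shift x y) m w.
Proof.
move=> /card_geP[X XC mX]; apply/card_geP.
exists (shift x @` X)%fset; last by rewrite card_imfset//; exact: shift_inj.
move=> z /= /imfsetP[u /= /XC + ->]; move=> /site_clusterP[wy [s ps <-]].
apply/site_clusterP; split=> //; exists (map (shift x) s); last by rewrite last_map.
rewrite path_map; apply: sub_path ps => a b /=.
by rewrite nn_adjacent_shift.
Qed.

Lemma big_cluster_shift x m w :
  big_cluster (origin d) m (w \o shift x) <-> big_cluster x m w.
Proof.
split; first by move/big_cluster_shift_sub; rewrite shift_origin.
(* The converse is the same inclusion applied to the opposite translation. *)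
pose x' : site d := [tuple - tnth x i | i < d].
have xK y : shift x (shift x' y) = y.
  by apply: eq_from_tnth => i; rewrite !tnth_mktuple addrNK.
have -> : origin d = shift x' x.
  by apply: eq_from_tnth => i; rewrite !tnth_mktuple subrr.
move=> wx; apply: big_cluster_shift_sub.
by rewrite (_ : _ \o _ = w)//; apply/funext => y /=; rewrite xK.
Qed.

(** The spacing is the side length of a cube of radius [m]. Only the nonnegative orthant receives
    centres, which costs a constant factor in their number. *)
Definition centre m N (f : {ffun 'I_d -> 'I_N}) : site d :=
  [tuple (m.*2.+1 * f i)%N%:Z | i < d].

(** A common site would bring the centres within 2m in every coordinate, whereas distinct multiples
    of 2m + 1 are further apart. *)
Lemma disjoint_centre m N (f g : {ffun 'I_d -> 'I_N}) : f != g ->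
  [disjoint cube_fset (centre m N f) m & cube_fset (centre m N g) m]%fset.
Proof.
move=> fg; apply/fdisjointP => y; rewrite !in_cube_fset => /forallP yf.
apply: contra fg => /forallP yg; apply/eqP/ffunP => i; apply: val_inj => /=.
move: (yf i) (yg i); rewrite !tnth_mktuple.
move: (tnth y i) (f i : nat) (g i : nat) => a b c ab ac.
have far j k : (j < k)%N -> (m.*2.+1 * j + m.*2.+1 <= m.*2.+1 * k)%N.
  by move=> jk; rewrite addnC -mulnS leq_pmul2l.
have [/far|/far|//] := ltngtP b c; move: (m.*2.+1 * b)%N (m.*2.+1 * c)%N ab ac;
  move=> *; lia.
Qed.

Lemma cube_centre_sub m N n (f : {ffun 'I_d -> 'I_N}) : (m.*2.+1 * N <= n)%N ->
  {subset cube (centre m N f) m <= box n}.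
Proof.
move=> Nn y /forallP yf; apply/forallP => i; move: (yf i); rewrite tnth_mktuple.
have : (m.*2.+1 * f i + m.*2.+1 <= n)%N.
  by apply: leq_trans Nn; rewrite addnC -mulnS leq_pmul2l// ltn_ord.
move: (tnth y i) (m.*2.+1 * f i)%N => a b; lia.
Qed.

End cluster_events.

(** * Union bound and independence bound for the maximal cluster *)

Section cluster_bounds.
Context {R : realType} {d : nat} {p : R} (P : probability (config d) R).
Hypothesis P_law : percolation_law p P.
Implicit Types (x : site d) (n m N : nat).

(** This is pi_m; translation invariance makes it the probability at every site. *)
Definition tail m : R := fine (P (big_cluster (origin d) m)).

Lemma tail_ge0 m : 0 <= tail m.
Proof. exact: fine_ge0. Qed.

Lemma tail_le1 m : tail m <= 1.
Proof.
rewrite -lee_fin fineK ?fin_num_measure ?probability_le1//;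
  exact: measurable_big_cluster.
Qed.

Lemma probability_big_cluster x m : P (big_cluster x m) = (tail m)%:E.
Proof.
rewrite fineK; last by rewrite fin_num_measure//; exact: measurable_big_cluster.
rewrite -(probability_reindex P_law _ _ _ (shift_inj x) (depends_on_big_cluster (origin d) m)).
congr (P _); apply/seteqP; split=> w; by rewrite /= big_cluster_shift.
Qed.

Definition some_big n m : set (config d) :=
  \big[setU/set0]_(x <- cube_fset (origin d) n) big_cluster x m.

Lemma measurable_some_big n m : measurable (some_big n m).
Proof. by apply: bigsetU_measurable => x _; exact: measurable_big_cluster. Qed.

Lemma probability_some_big n m :
  (P (some_big n m) <= ((n.*2.+1 ^ d)%:R * tail m)%:E)%E.
Proof.
apply: (@le_trans _ _ (#|` cube_fset (origin d) n|%:R * tail m)%:E); last first.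
  rewrite lee_fin ler_wpM2r ?tail_ge0// ler_nat; exact: card_cube_fset.
rewrite /some_big; elim: (enum_fset _) => [|x r IH].
  by rewrite big_nil measure0 mul0r.
rewrite big_cons; apply: le_trans (measureU2 _ _ _) _.
- exact: measurable_big_cluster.
- by apply: bigsetU_measurable => y _; exact: measurable_big_cluster.
rewrite /= -addn1 natrD mulrDl mul1r addrC EFinD leeD//.
by rewrite probability_big_cluster.
Qed.

Lemma max_cluster_some_big n m w (t : R) : 0 <= t -> m%:R <= t + 1 ->
  ~ some_big n m w -> max_cluster n w <= t.
Proof.
move=> t0 mt; apply: contra_notP => /negP; rewrite -ltNge => tM.
have [x xn tC] := max_cluster_gt n w t t0 tM.
rewrite /some_big -bigcup_seq /=; exists x => /=.
  by rewrite in_cube_fset -in_box.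
(* Sizes are integers, so [m - 1 <= t] and a size above [t] give at least [m] sites; the untruncated
   cluster has at least as many. *)
apply: card_ge_cluster_card; rewrite -ltnS -(ltr_nat R) (le_lt_trans mt)//.
by rewrite -natr1 ltrD2r; exact: tC.
Qed.

Definition no_big m N : set (config d) :=
  \big[setI/setT]_(f : {ffun 'I_d -> 'I_N}) ~` big_cluster (centre m N f) m.

Lemma measurable_no_big m N : measurable (no_big m N).
Proof.
apply: bigsetI_measurable => f _; apply: measurableC.
exact: measurable_big_cluster.
Qed.

Lemma probability_no_big m N : P (no_big m N) = ((1 - tail m) ^+ (N ^ d))%:E.
Proof.
rewrite /no_big (probability_bigI P_law _ _ (fun f => cube_fset (centre m N f) m)).
- under eq_bigr => f _.
    rewrite probability_setC; last exact: measurable_big_cluster.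
    rewrite probability_big_cluster -EFinB; over.
  by rewrite /= prodEFin prodr_const card_ffun !card_ord.
- by move=> f; exact/depends_onC/depends_on_big_cluster.
- have : uniq (index_enum {ffun 'I_d -> 'I_N}) by exact: index_enum_uniq.
  by rewrite uniq_pairwise; apply: sub_pairwise => f g; exact: disjoint_centre.
Qed.

Lemma max_cluster_no_big n m N w : (m.*2.+1 * N <= n)%N ->
  ~ no_big m N w -> m%:R <= max_cluster n w :> R.
Proof.
move=> Nn; rewrite /no_big -bigcap_seq => /existsNP[f /not_implyP[_ /contrapT fm]].
by apply: max_cluster_ge fm _; exact: cube_centre_sub.
Qed.

End cluster_bounds.

(** * Analytic tools: Borel-Cantelli and interpolation between powers of 2 *)

(** Bernoulli gives Kx <= (1 + x)^K, and (1 - x)^K (1 + x)^K = (1 - x^2)^K <= 1. *)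
Lemma exprn_onem_le (R : realFieldType) (x : R) K : 0 <= x <= 1 ->
  (1 - x) ^+ K * (K%:R * x) <= 1.
Proof.
move=> /andP[x0 x1]; have [y0 xp] : 0 <= 1 - x /\ 0 <= 1 + x by split; lra.
apply: (@le_trans _ _ ((1 - x) ^+ K * (1 + x) ^+ K)).
  apply: ler_wpM2l; first exact: exprn_ge0.
  elim: K => [|K IH]; first by rewrite mul0r expr0.
  have : 1 <= (1 + x) ^+ K by apply: exprn_ege1; lra.
  rewrite exprSr -natr1 => ?; nra.
rewrite -exprMn; apply: exprn_ile1; nra.
Qed.

Lemma ae_eventually_notin (R : realType) (disp : measure_display)
    (T : measurableType disp) (mu : {measure set T -> \bar R})
    (E : nat -> set T) (a r : R) :
  (forall k, measurable (E k)) -> 0 <= a -> 0 < r < 1 ->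
  (\forall k \near \oo, (mu (E k) <= (a * r ^+ k)%:E)%E) ->
  {ae mu, forall w, \forall k \near \oo, ~ E k w}.
Proof.
move=> mE a0 /andP[r0 r1] [N _ EN].
(* Dropping the first [N] events makes the geometric bound valid for every index, so the whole
   series is summable. *)
pose F k := E (k + N)%N.
have mF k : measurable (F k) by exact: mE.
exists (lim_sup_set F); split.
- by apply: bigcapT_measurable => k; exact: bigcup_measurable.
- apply: lim_sup_set_cvg0 => //.
  have ar0 : 0 <= a * r ^+ N by rewrite mulr_ge0// exprn_ge0// ltW.
  apply: (@le_lt_trans _ _ (a * r ^+ N / (1 - r))%:E); last by rewrite ltry.
  apply: lime_le; first exact: is_cvg_nneseries.
  apply: nearW => n.
  apply: (@le_trans _ _ (series (geometric (a * r ^+ N) r) n)%:E).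
    rewrite /series /= -sumEFin; apply: lee_sum => k _.
    rewrite -mulrA -exprD addnC; apply: EN; exact: leq_addl.
  by rewrite lee_fin geometric_le_lim// ger0_norm// ltW.
- move=> w /= wE n _; apply: contrapT => wF; apply: wE.
  exists (n + N)%N => // k /= nk Ek; apply: wF; exists (k - N)%N => /=.
    by rewrite leq_subRL ?(leq_trans (leq_addl n N))// addnC.
  by rewrite /F subnK// (leq_trans (leq_addl n N)).
Qed.

(** For 2^k <= n < 2^(k+1), monotonicity encloses f(n) between its values at the two powers, while
    log n lies between k log 2 and (k + 1) log 2; the ratio (k + 1)/k tends to 1. *)
Lemma cvg_div_ln_of_pow2 (R : realType) (f : nat -> R) (a : R) : 0 <= a ->
  (forall n, 0 <= f n) -> {homo f : m n / (m <= n)%N >-> m <= n} ->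
  (forall c, a < c -> \forall k \near \oo, f (2 ^ k)%N <= c * (k%:R * ln 2)) ->
  (forall c, c < a -> \forall k \near \oo, c * (k%:R * ln 2) <= f (2 ^ k)%N) ->
  (fun n => f n / ln n%:R : R) @ \oo --> a.
Proof.
move=> a0 f0 fh fle fge; apply/cvgrPdist_le => e e0.
have l0 : 0 < ln 2 :> R by rewrite ln_gt0// ltr1n.
have ale : a < a + e / 2 by rewrite ltrDl divr_gt0.
have age : a - e / 2 < a by rewrite gtrBl divr_gt0.
have [K1 _ K1P] := fle _ ale; have [K2 _ K2P] := fge _ age.
(* This is the size of [k] at which (a + e/2)(k + 1) <= (a + e)k; it also gives (a - e)(k + 1) <= (a
   - e/2)k. *)
have [K3 K3P] : exists K, forall k, (K <= k)%N -> (2 * a + e) / e <= k%:R.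
  by have [K _ KP] := nbhs_infty_ger ((2 * a + e) / e); exists K.
pose K := maxn K1 (maxn K2 (maxn K3 1)).
exists (2 ^ K)%N => // n /= Kn.
have n0 : (0 < n)%N by rewrite (leq_trans _ Kn)// expn_gt0.
pose k := trunc_log 2 n.
have Kk : (K <= k)%N by apply: trunc_log_max.
have kn : (2 ^ k <= n)%N by exact: trunc_logP.
have nk : (n <= 2 ^ k.+1)%N by apply/ltnW/trunc_log_ltn.
move: Kk; rewrite /K !geq_max => /and4P[K1k K2k K3k k1].
have kr : 0 < k%:R :> R by rewrite ltr0n.
have lnge : k%:R * ln 2 <= ln n%:R :> R.
  rewrite mulr_natl -lnXn// -natrX ler_ln ?posrE ?ltr0n ?expn_gt0//.
  by rewrite ler_nat.
have lnle : ln n%:R <= k.+1%:R * ln 2 :> R.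
  rewrite mulr_natl -lnXn// -natrX ler_ln ?posrE ?ltr0n ?expn_gt0//.
  by rewrite ler_nat.
have ln0 : 0 < ln n%:R :> R by rewrite (lt_le_trans _ lnge)// mulr_gt0.
have big_k : 2 * a + e <= k%:R * e by rewrite -ler_pdivrMr//; exact: K3P.
have upper := K1P k.+1 (leqW K1k); have lower := K2P k K2k.
have kS : k.+1%:R = k%:R + 1 :> R by rewrite natr1.
rewrite kS in upper lnle.
have fn1 := fh _ _ nk; have fn2 := fh _ _ kn.
rewrite ler_distlC ler_pdivlMr// ler_pdivrMr//; apply/andP; split.
  (* For a <= e the lower bound is nonpositive; otherwise its sign permits replacing log n by (k +
     1) log 2. *)
  have [ae|ae] := leP a e.
    by apply: le_trans (f0 n); rewrite pmulr_lle0// subr_le0.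
  apply: le_trans fn2; apply: le_trans lower.
  apply: (@le_trans _ _ ((a - e) * ((k%:R + 1) * ln 2))).
    by rewrite ler_wpM2l// subr_ge0 ltW.
  by rewrite !mulrA ler_wpM2r ?(ltW l0)//; nra.
apply: le_trans fn1 _; apply: le_trans upper _.
apply: (@le_trans _ _ ((a + e) * (k%:R * ln 2))); last first.
  by rewrite ler_wpM2l// addr_ge0// ltW.
by rewrite !mulrA ler_wpM2r ?(ltW l0)//; nra.
Qed.

(** * Exponential tail bounds and growth estimates *)

Section tail_rate.
Context {R : realType} {d : nat} (P : probability (config d) R).
Hypothesis zeta_cvg : cvgn (cluster_tail_rate P).

Lemma tail_le_expR (z : R) : z < zeta P ->
  \forall n \near \oo, tail P n <= expR (- (z * n%:R)).
Proof.
move=> zz; have cz : cluster_tail_rate P @ \oo --> zeta P by exact: zeta_cvg.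
have gtz := cvgr_gt _ cz _ zz; near=> n.
have n0 : 0 < n%:R :> R by rewrite ltr0n; near: n; exact: nbhs_infty_gt.
have [t0|t0] := leP (tail P n) 0; first by rewrite (le_trans t0)// expR_ge0.
have : z < cluster_tail_rate P n by near: n; exact: gtz.
rewrite /cluster_tail_rate -/(tail P n) -mulrN mulrC ltr_pdivlMr// => /ltW lnt.
by rewrite -[leLHS]lnK ?posrE// ler_expR lerNr.
Unshelve. all: by end_near. Qed.

Lemma tail_ge_expR (z : R) : 0 < zeta P -> zeta P < z ->
  \forall n \near \oo, expR (- (z * n%:R)) <= tail P n.
Proof.
move=> z0 zz; have cz : cluster_tail_rate P @ \oo --> zeta P by exact: zeta_cvg.
have gt0 := cvgr_gt _ cz _ z0; have ltz := cvgr_lt _ cz _ zz; near=> n.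
have n0 : 0 < n%:R :> R by rewrite ltr0n; near: n; exact: nbhs_infty_gt.
have : 0 < cluster_tail_rate P n by near: n; exact: gt0.
have : cluster_tail_rate P n < z by near: n; exact: ltz.
rewrite /cluster_tail_rate -/(tail P n) -mulrN mulrC ltr_pdivrMr// => /ltW lnt.
(* [ln] is 0 at nonpositive arguments, so a vanishing tail would have rate 0, against the rate being
   eventually positive. *)
have [t0|t0 _] := leP (tail P n) 0; first by rewrite ln0// oppr0 mul0r ltxx.
by rewrite -[leRHS]lnK ?posrE// ler_expR lerNl.
Unshelve. all: by end_near. Qed.
End tail_rate.

(** With b = (log 2)/2, 2^k = exp(kb)^2 >= (kb)^2, which exceeds Ak once k >= A/b^2. *)
Lemma near_linear_le_pow2 (R : realType) (A : R) : 0 <= A ->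
  \forall k \near \oo, A * k%:R <= (2 ^ k)%:R.
Proof.
move=> A0; pose b : R := ln 2 / 2.
have b0 : 0 < b by rewrite divr_gt0// ln_gt0// ltr1n.
near=> k.
have kA : A / (b * b) <= k%:R by near: k; exact: nbhs_infty_ger.
have -> : (2 ^ k)%:R = expR (k%:R * b) ^+ 2 :> R.
  rewrite -expRM_natl natrX -[X in X ^+ _]lnK ?posrE// -expRM_natl; congr expR.
  by rewrite /b; field.
have kb : 0 <= k%:R * b by rewrite mulr_ge0// ltW.
have kbe : k%:R * b <= expR (k%:R * b).
  by apply: le_trans (expR_ge1Dx _); rewrite lerDr.
apply: (@le_trans _ _ ((k%:R * b) ^+ 2)); last by rewrite lerXn2r// nnegrE// expR_ge0.
rewrite exprMn [X in _ <= X * _]expr2 -mulrA mulrC ler_wpM2l//.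
by rewrite expr2 -ler_pdivrMr// mulr_gt0.
Unshelve. all: by end_near. Qed.

(** The remainder is below B, and the quotient is positive, so rounding down loses at most a factor
    2. *)
Lemma leq_divn_double n B : (0 < B <= n)%N -> (n <= n %/ B * B.*2)%N.
Proof.
move=> /andP[B0 Bn]; have q1 : (0 < n %/ B)%N by rewrite divn_gt0.
rewrite -muln2 mulnA muln2 -addnn {1}(divn_eq n B) leq_add2l.
by apply: leq_trans (leq_pmull B q1); exact/ltnW/ltn_pmod.
Qed.

(** * Almost sure bounds along n = 2^k *)

Section almost_sure_bounds.
Context {R : realType} {d : nat} {p : R} (P : probability (config d) R).
Hypothesis P_law : percolation_law p P.
Hypothesis zeta_cvg : cvgn (cluster_tail_rate P).
Hypothesis zeta_gt0 : 0 < zeta P.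
Hypothesis d_gt0 : (0 < d)%N.

(** The cluster size m at scale n = 2^k, where log n = k log 2: c log n rounded up, exceeding it by
    at most 1. *)
Let threshold (c : R) k : nat := (Num.truncn (c * (k%:R * ln 2))).+1.

Let ln2_gt0 : 0 < ln 2 :> R. Proof. by rewrite ln_gt0// ltr1n. Qed.

Let expR_kln2 k : expR (k%:R * ln 2) = (2 ^ k)%:R :> R.
Proof. by rewrite expRM_natl lnK ?posrE// natrX. Qed.

Let threshold_itv (c : R) k : 0 < c ->
  c * (k%:R * ln 2) <= (threshold c k)%:R <= c * (k%:R * ln 2) + 1.
Proof.
move=> c0; have t0 : 0 <= c * (k%:R * ln 2) by rewrite !mulr_ge0// ltW.
have /andP[tl tu] := truncn_itv t0.
by rewrite (ltW tu) /threshold -[leLHS]natr1 lerD2r tl.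
Qed.

Let threshold_cvg (c : R) (Q : set nat) : 0 < c -> (\forall m \near \oo, Q m) ->
  \forall k \near \oo, Q (threshold c k).
Proof.
move=> c0 [M _ MQ]; have [K _ KP] := nbhs_infty_ger (M%:R / (c * ln 2)).
exists K => // k /= /KP; rewrite ler_pdivrMr ?mulr_gt0// => Mk; apply: MQ => /=.
have /andP[+ _] := threshold_itv _ k c0; rewrite -(ler_nat R); apply: le_trans.
by rewrite (le_trans Mk)// mulrCA.
Qed.

Lemma ae_max_cluster_le (c : R) : d%:R / zeta P < c ->
  {ae P, forall w, \forall k \near \oo,
     max_cluster (2 ^ k) w <= c * (k%:R * ln 2)}.
Proof.
move=> dc; have c0 : 0 < c by apply: le_lt_trans dc; rewrite divr_ge0// ltW.
have dz : d%:R / c < zeta P by rewrite ltr_pdivrMr// mulrC -ltr_pdivrMr.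
(* The midpoint of d/c and zeta: below zeta, so that pi_m <= exp(-zm) eventually, and with zc > d,
   so that this beats the volume of the box. *)
pose z := (d%:R / c + zeta P) / 2.
have zz : z < zeta P by rewrite /z; lra.
have zc : d%:R < z * c by rewrite -ltr_pdivrMr// /z; lra.
have z0 : 0 < z by rewrite -(pmulr_lgt0 _ c0) (le_lt_trans _ zc).
pose r := expR (- ((z * c - d%:R) * ln 2)).
have r1 : 0 < r < 1 by rewrite expR_gt0 expR_lt1 oppr_lt0 mulr_gt0// subr_gt0.
have : {ae P, forall w, \forall k \near \oo,
    ~ some_big (2 ^ k) (threshold c k) w}.
  (* The base 3 comes from 2 * 2^k + 1 <= 3 * 2^k; what remains is (2^k)^(d - zc) = r^k. *)
  apply: (@ae_eventually_notin _ _ _ _ _ (3 ^+ d) r) => //.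
    by move=> k; exact: measurable_some_big.
  have := threshold_cvg _ _ c0 (tail_le_expR P zeta_cvg _ zz).
  apply: filterS => k tailk.
  apply: le_trans (probability_some_big P P_law _ _) _.
  rewrite lee_fin.
  apply: (@le_trans _ _ ((3 * (2 ^ k)%:R) ^+ d * expR (- (z * (c * (k%:R * ln 2)))))).
    apply: ler_pM; rewrite ?tail_ge0//.
      rewrite natrX lerXn2r ?nnegrE//; rewrite -natrM ler_nat -addn1 -mul2n.
      by rewrite (mulnDl 2 1) leq_add2l mul1n expn_gt0.
    apply: le_trans tailk _; rewrite ler_expR lerN2 ler_pM2l//.
    by have /andP[] := threshold_itv _ k c0.
  rewrite exprMn -mulrA ler_pM2l ?exprn_gt0//.
  rewrite -expR_kln2 -expRM_natl -expRD /r -expRM_natl ler_expR; lra.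
apply: filterS => w; apply: filterS => k.
apply: max_cluster_some_big.
  by rewrite !mulr_ge0// ltW.
by have /andP[] := threshold_itv _ k c0.
Qed.

Lemma ae_max_cluster_ge (c : R) : c < d%:R / zeta P ->
  {ae P, forall w, \forall k \near \oo,
     c * (k%:R * ln 2) <= max_cluster (2 ^ k) w}.
Proof.
move=> cd; have [c0|c0] := leP c 0.
  apply: aeW => w; apply: nearW => k; apply: le_trans (max_cluster_ge0 _ _).
  by rewrite mulr_le0_ge0// mulr_ge0// ltW.
have dz : zeta P < d%:R / c by rewrite ltr_pdivlMr// mulrC -ltr_pdivlMr.
have d0 : 0 < d%:R :> R by rewrite ltr0n.
(* A quarter of the gap: one [e] goes to the tail bound, one to the number of cubes, and z = zeta +
   2e is still below d/c. *)
pose e := (d%:R / c - zeta P) / 4.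
have e0 : 0 < e by rewrite /e; lra.
pose z := zeta P + 2 * e.
have zz : zeta P < zeta P + e by rewrite ltrDl.
have zc : z * c < d%:R by rewrite -ltr_pdivlMr// /z /e; lra.
have z0 : 0 < z by rewrite addr_gt0// mulr_gt0.
pose r := expR (- ((d%:R - z * c) * ln 2)).
have r1 : 0 < r < 1 by rewrite expR_gt0 expR_lt1 oppr_lt0 mulr_gt0// subr_gt0.
(* The excess [e] of the exponent absorbs the factor (4m + 2)^d. *)
pose C := 2 + 4 * d%:R / e.
have C0 : 0 < C by rewrite /C addr_gt0// divr_gt0// mulr_gt0.
have C_expR m : (m.*2.+1).*2%:R ^+ d <= C ^+ d * expR (e * m%:R) :> R.
  have -> : expR (e * m%:R) = expR (e * m%:R / d%:R) ^+ d.
    by rewrite -expRM_natl; congr expR; field; rewrite gt_eqF.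
  rewrite -exprMn lerXn2r ?nnegrE// ?mulr_ge0// ?expR_ge0 ?(ltW C0)//.
  (* After taking d-th roots, C >= 2 covers the constant term of 4m + 2 and C >= 4d/e its linear
     term. *)
  apply: (@le_trans _ _ (C * (1 + e * m%:R / d%:R))); last first.
    by rewrite ler_pM2l// expR_ge1Dx.
  have -> : m.*2.+1.*2%:R = 2 + 4 * m%:R :> R.
    by rewrite -!mul2n mulnS natrD mulnA natrM.
  have -> : C * (1 + e * m%:R / d%:R) =
      2 + 4 * m%:R + (4 * d%:R / e + 2 * (e * m%:R / d%:R)).
    by rewrite /C; field; rewrite !gt_eqF.
  have ? : 0 <= e * m%:R / d%:R by rewrite divr_ge0// mulr_ge0// ltW.
  have ? : 0 <= 4 * d%:R / e by apply: divr_ge0; [rewrite mulr_ge0|exact: ltW].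
  by rewrite lerDl addr_ge0// mulr_ge0.
pose m k := threshold c k; pose N k := (2 ^ k %/ (m k).*2.+1)%N.
have : {ae P, forall w, \forall k \near \oo, ~ no_big (m k) (N k) w}.
  apply: (@ae_eventually_notin _ _ _ _ _ (C ^+ d * expR z) r) => //.
  - by move=> k; exact: measurable_no_big.
  - by rewrite mulr_ge0 ?expR_ge0// exprn_ge0// ltW.
  have tailm := threshold_cvg _ _ c0 (tail_ge_expR P zeta_cvg _ zeta_gt0 zz).
  (* For k >= 1, 2m + 1 <= 2ck log 2 + 3 <= (2c log 2 + 3)k, so eventually a cube fits and N is
     positive. *)
  have A0 : 0 <= 2 * (c * ln 2) + 3.
    by rewrite addr_ge0// mulr_ge0// mulr_ge0// ltW.
  have pow2 := near_linear_le_pow2 _ _ A0.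
  near=> k.
  have tailk : expR (- ((zeta P + e) * (m k)%:R)) <= tail P (m k).
    by near: k; exact: tailm.
  have pow2k : (2 * (c * ln 2) + 3) * k%:R <= (2 ^ k)%:R by near: k; exact: pow2.
  have k1 : 1 <= k%:R :> R by rewrite ler1n; near: k; exact: nbhs_infty_gt.
  have /andP[mge mle] := threshold_itv _ k c0; rewrite -/(m k) in mge mle.
  have mk : ((m k).*2.+1 <= 2 ^ k)%N.
    rewrite -(ler_nat R); apply: le_trans pow2k.
    rewrite -[leLHS]natr1 -mul2n natrM; nra.
  have /leq_divn_double : (0 < (m k).*2.+1 <= 2 ^ k)%N by [].
  rewrite -/(N k) => Nk.
  apply: (@le_trans _ _ ((1 - tail P (m k)) ^+ (N k ^ d))%:E).
    by rewrite -(probability_no_big P P_law).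
  rewrite lee_fin.
  pose K : R := (N k ^ d)%:R * tail P (m k).
  have Y0 : 0 < C ^+ d * expR z * r ^+ k.
    by rewrite !mulr_gt0 ?exprn_gt0 ?expR_gt0.
  (* Since (1 - pi_m)^(N^d) <= 1/K, a geometric lower bound on K is enough for Borel-Cantelli. *)
  have K_ge : (C ^+ d * expR z * r ^+ k)^-1 <= K.
    have NC : (2 ^ k)%:R ^+ d * expR (- (e * (m k)%:R)) <= (N k ^ d)%:R * C ^+ d.
      rewrite expRN ler_pdivrMr ?expR_gt0// -mulrA.
      apply: (@le_trans _ _ ((N k * (m k).*2.+1.*2)%:R ^+ d)).
        by rewrite lerXn2r ?nnegrE// ler_nat.
      by rewrite natrM exprMn natrX ler_wpM2l// exprn_ge0.
    rewrite -[leLHS]mul1r ler_pdivrMr//.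
    have -> : K * (C ^+ d * expR z * r ^+ k) =
        (N k ^ d)%:R * C ^+ d * tail P (m k) * (expR z * r ^+ k).
      by rewrite /K; ring.
    apply: (@le_trans _ _ ((2 ^ k)%:R ^+ d * expR (- (e * (m k)%:R)) *
      expR (- ((zeta P + e) * (m k)%:R)) * (expR z * r ^+ k))); last first.
      rewrite ler_wpM2r ?mulr_ge0 ?exprn_ge0 ?expR_ge0//.
      by rewrite ler_pM// ?mulr_ge0 ?exprn_ge0 ?expR_ge0.
    (* The exponents add up to z(ck log 2 + 1 - m), which is nonnegative; the factor exp(z) pays for
       rounding m up. *)
    rewrite -expR_kln2 /r -!expRM_natl -!expRD -[leLHS]expR0 ler_expR.
    have : z * (m k)%:R <= z * (c * (k%:R * ln 2) + 1) by rewrite ler_pM2l.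
    rewrite /z; lra.
  rewrite -[leRHS]invrK -[leRHS]mul1r ler_pdivlMr ?invr_gt0//.
  have /(exprn_onem_le _ _ (N k ^ d)) : 0 <= tail P (m k) <= 1.
    by rewrite tail_ge0 tail_le1.
  apply: le_trans.
  by rewrite ler_wpM2l// exprn_ge0// subr_ge0 tail_le1.
apply: filterS => w; apply: filterS => k /max_cluster_no_big ge_m.
have /andP[mge _] := threshold_itv _ k c0; apply: le_trans mge _; apply: ge_m.
by rewrite mulnC leq_trunc_div.
Unshelve. all: by end_near. Qed.

End almost_sure_bounds.

Theorem theorem1p3 (R : realType) (d : nat) (p : R)
    (P : probability (config d) R)
    (d_ge1 : (1 <= d)%N)
    (p_gt0 : 0 < p) (p_lt_pc : p < p_c R d)
    (P_law : percolation_law p P)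
    (zeta_cvg : cvgn (cluster_tail_rate P)) (zeta_gt0 : 0 < zeta P) :
  {ae P, forall w : config d,
     (fun n : nat => max_cluster n w / ln n%:R : R) @ \oo --> d%:R / zeta P}.
Proof.
have a0 : 0 <= d%:R / zeta P by rewrite divr_ge0// ltW.
(* Countably many levels around the limit are used, so a single null set serves for all of them; any
   other level is compared with one of these. *)
have a_lt j : d%:R / zeta P < d%:R / zeta P + j.+1%:R^-1 by rewrite ltrDl.
have a_gt j : d%:R / zeta P - j.+1%:R^-1 < d%:R / zeta P by rewrite gtrBl.
have upper := ae_foralln (fun j =>
  ae_max_cluster_le P P_law zeta_cvg zeta_gt0 _ (a_lt j)).
have lower := ae_foralln (fun j =>
  ae_max_cluster_ge P P_law zeta_cvg zeta_gt0 d_ge1 _ (a_gt j)).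
apply: filterS2 upper lower => w upper lower.
have inv_small (e : R) : 0 < e -> exists j : nat, j.+1%:R^-1 < e.
  by move=> e0; have [j _ /(_ j (leqnn j))] := near_infty_natSinv_lt (PosNum e0); exists j.
have kln2_ge0 k : 0 <= k%:R * ln 2 :> R by rewrite mulr_ge0// ln_ge0// ler1n.
apply: cvg_div_ln_of_pow2 => // [n|m n||].
- exact: max_cluster_ge0.
- exact: max_cluster_le.
- move=> c; rewrite -subr_gt0 => /inv_small[j jc].
  apply: filterS (upper j) => k /le_trans; apply.
  by rewrite ler_wpM2r// -lerBrDl ltW.
- move=> c; rewrite -subr_gt0 => /inv_small[j jc].
  apply: filterS (lower j) => k; apply: le_trans.
  by rewrite ler_wpM2r// lerBrDr -lerBrDl ltW.
Qed.
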